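(* Let $k\leq n$ be two positive integers, let $g=\gcd(n,k)$, and let $M=M(n,k)$ be the $(n,k)$-wreath matrix. The following are equivalent. (a) It is possible to decompose $\mathbb{Z}_n^{(k)}$ into disjoint $(n,k)$-wreaths, i.e. there is a set of pairwise disjoint $(n,k)$-wreaths whose union is $\mathbb{Z}_n^{(k)}$. (b) There is $v\in\ker M$ whose entries take only two distinct values, one of which is attained exactly $\frac{g\binom{n}{k}}{n}$ times. (c) If $k\nmid n$, there is $v\in\ker M$ with at most $\frac{g\binom{n}{k}}{n}$ positive entries and less than $\frac{(n-k)!\,k!}{2(g!)^{n/g}}$ zero entries. If $k\mid n$, there is $v\in\ker M$ with at most $\binom{n-1}{k-1}$ positive entries and less than $\frac{n(n-k)!}{k(k!)^{n/k-1}(\frac{n}{k})!}$ zero entries. (d) There is $v\in\ker M$ with at most $\frac{g\binom{n}{k}}{n}$ positive entries and such that each subset of $\mathbb{Z}_n$ of size $k$ is contained (as an element) in some wreath $\mathcal{F}$ which labels a negative entry of $v$.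
   Context: For positive integers $k\le n$, $\mathbb{Z}_n$ is the set of integers modulo $n$ and $\mathbb{Z}_n^{(k)}$ is the set of subsets of $\mathbb{Z}_n$ of size $k$. For a bijection $\pi:\mathbb{Z}_n\to\mathbb{Z}_n$, the $(n,k,\pi)$-wreath is the family $\mathcal{F}_\pi=\{\{\pi((i-1)k+1),\pi((i-1)k+2),\ldots,\pi(ik)\} : i\in\mathbb{Z}_n\}\subset\mathbb{Z}_n^{(k)}$ (arguments of $\pi$ taken modulo $n$). An $(n,k)$-wreath is a family of the form $\mathcal{F}_\pi$ for some such $\pi$, and $\mathcal{W}_{n,k}$ is the set of all $(n,k)$-wreaths (two permutations giving the same family give the same wreath). The $(n,k)$-wreath matrix $M=M(n,k)$ is the square matrix with rows and columns labelled by $\mathcal{W}_{n,k}$ and entries $M_{\mathcal{F},\mathcal{F}'}=|\mathcal{F}\cap\mathcal{F}'|$. Vectors $v\in\ker M$ are real vectors indexed by $\mathcal{W}_{n,k}$.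
   Formalization: The cases k = 1, k = n−1, k = n and n = 2k are excluded: there distinct wreaths are disjoint, M is an invertible scalar matrix, so ker M = 0, and (a) holds while (d) fails. *)

(* Defs.v *)
From mathcomp Require Import all_boot all_order all_fingroup all_algebra.
From mathcomp Require Import reals.

Set Implicit Arguments.
Unset Strict Implicit.
Unset Printing Implicit Defensive.

Import Order.TTheory GRing.Theory Num.Theory.
Local Open Scope ring_scope.

(* Z_n is represented by 'I_n, with congruences taken on nat, so that every
   n is covered ('Z_n would not be Z/n for n = 1). *)

Definition ksubsets (n k : nat) : {set {set 'I_n}} :=
  [set A : {set 'I_n} | #|A| == k].

(* The index i stands for i - 1 in the usual formula
   {pi((i-1)k+1), ..., pi(ik)}; both range over all residues modulo n. *)
Definition wreath_block (n k : nat) (pi : {perm 'I_n}) (i : 'I_n) :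
    {set 'I_n} :=
  [set pi x | x : 'I_n & [exists j : 'I_k, x == i * k + j.+1 %[mod n]]]%N.

Definition wreath_of (n k : nat) (pi : {perm 'I_n}) : {set {set 'I_n}} :=
  [set wreath_block k pi i | i : 'I_n].

Definition wreaths (n k : nat) : {set {set {set 'I_n}}} :=
  [set wreath_of k pi | pi : {perm 'I_n}].

(* Rows, columns and vector entries are labelled by wreaths through the
   enumeration enum_val : 'I_#|wreaths n k| -> {set {set 'I_n}}. *)
Definition wreath (n k : nat) (i : 'I_#|wreaths n k|) : {set {set 'I_n}} :=
  enum_val i.

Definition wreath_matrix (R : realType) (n k : nat) : 'M[R]_#|wreaths n k| :=
  \matrix_(i, j) #|wreath i :&: wreath j|%:R.

Definition in_ker (R : realType) (m : nat) (M : 'M[R]_m) (v : 'cV[R]_m) :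
    Prop :=
  M *m v = 0.

Definition entries_eq (R : realType) (m : nat) (v : 'cV[R]_m) (a : R) : nat :=
  #|[set i | v i 0 == a]|.

Definition entries_pos (R : realType) (m : nat) (v : 'cV[R]_m) : nat :=
  #|[set i | 0 < v i 0]|.

Definition wreath_decomposable (n k : nat) : Prop :=
  exists D : {set {set {set 'I_n}}},
    [/\ D \subset wreaths n k, trivIset D & cover D = ksubsets n k].

(* Main.v *)
Require Import Defs.
From mathcomp Require Import all_boot all_order all_fingroup all_algebra.
From mathcomp Require Import reals zify.

Set Implicit Arguments.
Unset Strict Implicit.
Unset Printing Implicit Defensive.

Import Order.TTheory GRing.Theory Num.Theory.

(** A vector [v] is in the kernel of the wreath matrix exactly when, for every
    set [A], the entries of [v] at the wreaths containing [A] sum to zero: the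
    matrix is the Gram matrix of the indicator vectors of the wreaths, so its
    quadratic form is the sum of the squares of these partial sums ([in_kerP]).

    Write [n = m * g] and [k = h * g] with [g] the gcd, so that [m] and [h] are
    coprime.  Cut Z_n into [m] consecutive runs of length [g]; up to a
    permutation, a wreath consists of the [m] unions of [h] cyclically
    consecutive runs.  The wreaths thus form one orbit of the symmetric group,
    each has [m] members, and every k-subset lies in the same number [d > 0] of
    them, with [d * 'C(n, k) = m * #|wreaths|] ([degree_count]).

    From a decomposition [D], the vector with value [d - 1] on [D] and [-1]
    elsewhere is in the kernel, and both values occur because some two distinct
    wreaths share a member ([wreaths_overlap]).  The entries of a kernel vector
    have total zero, so two values that are both attained are nonzero and of
    opposite signs; up to sign the prescribed value is the positive one, and
    (c) follows with no zero entry at all.  If (d) holds, every k-subset, being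
    in a wreath with a negative entry, is also in one with a positive entry;
    the at most ['C(n, k) / m] positive wreaths have at most ['C(n, k)] members
    counted with multiplicity, hence cover every k-subset exactly once.

    It remains to derive (d) from (c).  A kernel vector with fewer than [d]
    zero entries has a nonzero entry, hence a negative one, at some wreath
    containing any given k-subset ([neg_of_few_zeros]).  When [1 < h < m - 1]
    the bound of (c) is at most [d]: a permutation preserving a wreath acts on
    its cyclic sequence of members by one of at most [2 * m] symmetries, and is
    determined up to the [g! ^ m] permutations preserving each run
    ([card_stab_base], [degree_ge]).  When [h = 1] or [h = m - 1], the wreaths
    are the partitions into g-sets, or their complements.  For [h = m - 1] they
    have more symmetries, and the bound of (c) can exceed [d]; it can even
    exceed the number of all wreaths, and then the zero vector satisfies (c).
    In these cases (a) holds outright by Baranyai's theorem ([baranyai]), which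
    is proved by adding one point at a time, each time choosing with Hall's
    theorem ([hall_capacity]) the block that receives it. *)

(** * Hall's theorem with capacities *)

Section Hall.
Local Open Scope nat_scope.
Variables (I T : finType) (cap : T -> nat).

Definition hall_condition (N : I -> {set T}) :=
  forall J : {set I}, #|J| <= \sum_(t in \bigcup_(i in J) N i) cap t.

Definition drop_edge (N : I -> {set T}) i t : I -> {set T} :=
  fun j => if j == i then N i :\ t else N j.

(** The violating [J0] must contain [i], since the other neighbourhoods did not
    change; [J] is [J0] without [i], and [J0] having one more element turns the
    strict inequality into a weak one. *)
Lemma hall_violation (N : I -> {set T}) i t :
  hall_condition N -> ~ hall_condition (drop_edge N i t) ->
  exists2 J : {set I}, i \notin J &
    \sum_(s in (\bigcup_(j in J) N j) :|: (N i :\ t)) cap s <= #|J|.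
Proof.
move=> hallN nhall.
have [J0 J0v] : exists J : {set I},
    ~~ (#|J| <= \sum_(s in \bigcup_(j in J) drop_edge N i t j) cap s).
  apply/existsP; apply: contraT => /existsPn nex; case: nhall => J.
  by have := nex J; rewrite negbK.
have other (J : {set I}) : i \notin J ->
    \bigcup_(j in J) drop_edge N i t j = \bigcup_(j in J) N j.
  move=> iJ; apply: eq_bigr => j jJ; rewrite /drop_edge.
  by case: eqP jJ iJ => // -> ->.
have [iJ0|iJ0] := boolP (i \in J0); last first.
  by move: J0v; rewrite other // hallN.
exists (J0 :\ i); first by rewrite !inE eqxx.
move: J0v; rewrite (big_setD1 i) //= other ?inE ?eqxx //.
by rewrite -ltnNge (cardsD1 i J0) iJ0 /drop_edge eqxx setUC.
Qed.

(** Rado's argument: if both deletions break the condition, take the violating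
    sets [J1] and [J2] and let [X1] and [X2] be their neighbourhoods after
    deletion.  [X1 :|: X2] contains the neighbourhood of [i |: (J1 :|: J2)], as
    each deletion keeps the point lost by the other, and [X1 :&: X2] contains
    that of [J1 :&: J2].  As capacity is modular, the condition for these two
    sets exceeds the sum of the two violations by one. *)
Lemma hall_drop_edge (N : I -> {set T}) i t1 t2 :
  hall_condition N -> t1 != t2 -> t1 \in N i -> t2 \in N i ->
  hall_condition (drop_edge N i t1) \/ hall_condition (drop_edge N i t2).
Proof.
move=> hallN t12 t1N t2N.
pose ok t := [forall J : {set I},
  #|J| <= \sum_(s in \bigcup_(j in J) drop_edge N i t j) cap s].
have okP t : reflect (hall_condition (drop_edge N i t)) (ok t).
  exact: forallP.
have [/okP|/okP n1] := boolP (ok t1); first by left.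
have [/okP|/okP n2] := boolP (ok t2); first by right.
have [J1 iJ1 le1] := hall_violation hallN n1.
have [J2 iJ2 le2] := hall_violation hallN n2.
set X1 := _ :|: _ in le1; set X2 := _ :|: _ in le2.
pose w (X : {set T}) := \sum_(s in X) cap s.
have wS (X Y : {set T}) : X \subset Y -> w X <= w Y.
  move=> sXY; rewrite /w [leqRHS](big_setID X) /= (setIidPr sXY).
  exact: leq_addr.
have modular : w (X1 :|: X2) + w (X1 :&: X2) = w X1 + w X2.
  rewrite /w (big_setID X1) /= (setIidPr (subsetUl _ _)) setDUl setDv set0U.
  by rewrite [in RHS](big_setID (A := X2) X1) /= setIC addnAC -addnA.
have sub : \bigcup_(j in i |: (J1 :|: J2)) N j \subset X1 :|: X2.
  apply/bigcupsP => j; rewrite !inE => /or3P[/eqP->|jJ|jJ].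
  - apply/subsetP => s sN; rewrite !inE sN !andbT.
    by case: (eqVneq s t1) => [->|_]; rewrite ?t12 ?orbT.
  - by apply: subset_trans (subsetUl _ _); apply: subset_trans (subsetUl _ _);
       apply: bigcup_sup.
  - by apply: subset_trans (subsetUr _ _); apply: subset_trans (subsetUl _ _);
       apply: bigcup_sup.
have subI : \bigcup_(j in J1 :&: J2) N j \subset X1 :&: X2.
  apply/bigcupsP => j; rewrite inE => /andP[jJ1 jJ2].
  by rewrite subsetI; apply/andP; split;
     apply: subset_trans (subsetUl _ _); apply: bigcup_sup.
have := leq_add (leq_trans (hallN _) (wS _ _ sub))
                (leq_trans (hallN _) (wS _ _ subI)).
rewrite modular cardsU1 !inE negb_or iJ1 iJ2 /= -addnA cardsUI.
by move/leq_trans => /(_ _ (leq_add le1 le2)); rewrite add1n ltnn.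
Qed.

(** Delete edges until every [i] has a single neighbour: that neighbour is
    [f i], and the condition for a fibre of [f] is the capacity bound. *)
Theorem hall_capacity (N : I -> {set T}) :
  hall_condition N ->
  exists f : I -> T, (forall i, f i \in N i) /\
    forall t, #|[set i | f i == t]| <= cap t.
Proof.
have [m] := ubnP (\sum_i #|N i|); elim: m N => // m IH N ltm hallN.
have N_gt0 i : 0 < #|N i|.
  rewrite card_gt0; apply/eqP => N0; have := hallN [set i].
  by rewrite cards1 big_set1 N0 big_set0.
have [/existsP[i Ngt1]|/existsPn Nle1] := boolP [exists i, 1 < #|N i|].
  have [t1 [t2 [t1N t2N t12]]] := card_gt1P Ngt1.
  suff [t tN hallD] : exists2 t, t \in N i & hall_condition (drop_edge N i t).
    have [||f [fN fcap]] := IH (drop_edge N i t); last 1 first.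
    - exists f; split=> // j; have := fN j; rewrite /drop_edge.
      by case: eqP => // ->; rewrite inE => /andP[].
    - rewrite (leq_trans _ (ltnSE ltm)) // (bigD1 i) //= [ltnRHS](bigD1 i) //=.
      rewrite /drop_edge eqxx (cardsD1 t (N i)) tN add1n addSn ltnS leq_add2l.
      by apply: leq_sum => j /negPf ->.
    - exact: hallD.
  by have [h|h] := hall_drop_edge hallN t12 t1N t2N; [exists t1|exists t2].
have [f fN] : exists f : I -> T, forall i, f i \in N i.
  by apply: (fin_all_exists (P := fun i t => t \in N i)) => i;
     apply/existsP; have /card_gt0P[t tN] := N_gt0 i; apply/existsP; exists t.
have NE i : N i = [set f i].
  apply/eqP; rewrite eq_sym eqEcard sub1set fN cards1 -ltnS.
  by move: (Nle1 i); rewrite -leqNgt ltnS.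
exists f; split=> // t.
apply: leq_trans (hallN _) _.
set X := \bigcup_(_ in _) _.
have sX : X \subset [set t].
  by apply/bigcupsP => i; rewrite inE NE => /eqP ->.
rewrite -[leqRHS](big_set1 addn t cap) [leqRHS](big_setID X) /=.
by rewrite (setIidPr sX) leq_addr.
Qed.

End Hall.

(** * Baranyai's theorem *)

Section Baranyai.
Local Open Scope nat_scope.
Variables (T : finType) (g m : nat).
Hypotheses (g_gt0 : 0 < g) (cardT : #|T| = m * g).
Let n := #|T|.
Let I := 'I_('C(n.-1, g.-1)).

(** The number of g-subsets of [T] that meet a fixed l-subset [X] in a given
    s-subset of [X].  The test [s <= g] is there because [g - s] truncates. *)
Definition ext_count (l s : nat) := if s <= g then 'C(n - l, g - s) else 0.

(** The trace on [X] of a list of partitions of [T] into g-sets indexed by [I]: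
    [mu i S] is the number of blocks of the i-th partition that meet [X] in
    [S].  It is a multiplicity because several blocks may avoid [X]. *)
Definition partial_baranyai (X : {set T}) (mu : I -> {set T} -> nat) :=
  [/\ forall i S, 0 < mu i S -> S \subset X,
      forall i, \sum_S mu i S = m,
      forall i x, x \in X -> \sum_(S : {set T} | x \in S) mu i S = 1
    & forall S : {set T}, S \subset X -> \sum_i mu i S = ext_count #|X| #|S|].

Lemma ext_count_pascal l s : l < n ->
  ext_count l s = ext_count l.+1 s + ext_count l.+1 s.+1.
Proof.
move=> ltln; rewrite /ext_count; case: ltngtP => // [lts|->].
  by rewrite -(subnSK ltln) -(subnSK lts) binS.
by rewrite subnn !bin0.
Qed.

Lemma ext_count_diag l s : l < n ->
  (n - l) * ext_count l.+1 s.+1 = (g - s) * ext_count l s.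
Proof.
move=> ltln; rewrite /ext_count; case: ltngtP => // [lts|gts|->].
- by rewrite subnS mul_bin_diag subnSK.
- by rewrite !muln0.
- by rewrite subnn mul0n muln0.
Qed.

Lemma partial_baranyai0 : partial_baranyai set0
  (fun _ S => if S == set0 then m else 0).
Proof.
split=> [_ S|i|i x|S]; first by case: eqP => // ->; rewrite subxx.
- by rewrite -big_mkcond big_pred1_eq.
- by rewrite inE.
rewrite subset0 => /eqP ->; rewrite eqxx cards0 /ext_count leq0n !subn0.
rewrite sum_nat_const card_ord.
apply/eqP; rewrite -(eqn_pmul2l g_gt0).
have := mul_bin_diag n g.-1; rewrite (prednK g_gt0) => <-.
by rewrite mulnCA mulnC (mulnC g) -cardT.
Qed.

Lemma sum_size_partial X mu i : partial_baranyai X mu ->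
  \sum_(S : {set T}) #|S| * mu i S = #|X|.
Proof.
case=> [suppX _ coverX _].
under eq_bigr => S _ do rewrite -sum1_card big_distrl /=.
rewrite (exchange_big_dep predT) //=.
rewrite (eq_bigr (fun x => \sum_(S : {set T} | x \in S) mu i S)); last first.
  by move=> x _; apply: eq_bigr => S _; rewrite mul1n.
rewrite (bigID (mem X)) /= [X in _ + X]big1 ?addn0.
  by rewrite (eq_bigr (fun=> 1)) ?sum1_card // => x xX; apply: coverX.
move=> x xX; apply: big1 => S xS; apply/eqP; rewrite -leqn0 leqNgt.
by apply: contra xX => /suppX /subsetP; apply.
Qed.

Lemma size_support X mu i S : partial_baranyai X mu -> 0 < mu i S -> #|S| <= g.
Proof.
case=> [suppX _ _ countX] mu_gt0; have := countX _ (suppX _ _ mu_gt0).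
rewrite /ext_count; case: leqP => // _ /eqP.
by rewrite sum_nat_eq0 => /forallP/(_ i); rewrite -leqn0 leqNgt mu_gt0.
Qed.

(** The weight [g - #|S|] of a trace is the number of points that its block
    still lacks, so the total is the number of points outside [X]. *)
Lemma weight_partial X mu i : partial_baranyai X mu ->
  \sum_(S : {set T}) (g - #|S|) * mu i S = n - #|X|.
Proof.
move=> pb; rewrite -(sum_size_partial i pb) /n cardT.
case: (pb) => _ /(_ i) <- _ _; rewrite big_distrl /=.
rewrite [X in _ = X - _](eq_bigr (fun S : {set T} =>
  (g - #|S|) * mu i S + #|S| * mu i S)).
  by rewrite big_split /= addnK.
move=> S _; have [-> |mu_gt0] := posnP (mu i S); first by rewrite !muln0.
by rewrite -mulnDl subnK ?(size_support pb mu_gt0) // mulnC.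
Qed.

(** A new point must join one block [f i] of each partial partition, and the
    trace [S] must be chosen the right number of times.  Choosing [S] for [i]
    with probability [(g - #|S|) * mu i S / (n - #|X|)] meets both demands on
    average; Hall's theorem makes the choice integral.  As the capacities add
    up to the number of partitions, all the bounds are equalities. *)
Lemma choose_extension X mu : partial_baranyai X mu -> #|X| < n ->
  exists f : I -> {set T}, (forall i, 0 < mu i (f i)) /\
    forall S : {set T}, S \subset X ->
      #|[set i | f i == S]| = ext_count #|X|.+1 #|S|.+1.
Proof.
move=> pb ltX; case: (pb) => suppX _ _ countX.
pose cap (S : {set T}) := if S \subset X then ext_count #|X|.+1 #|S|.+1 else 0.
pose N i := [set S | 0 < mu i S].
have capE (S : {set T}) : (n - #|X|) * cap S = \sum_i (g - #|S|) * mu i S.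
  rewrite /cap -big_distrr /=; case: ifP => [sSX|/negP nSX].
    by rewrite countX // ext_count_diag.
  rewrite muln0 big1 ?muln0 // => i _; apply/eqP; rewrite -leqn0 leqNgt.
  by apply/negP => /suppX.
have rX : 0 < n - #|X| by rewrite subn_gt0.
have hallN : hall_condition cap N.
  move=> J; rewrite -(leq_pmul2l rX) big_distrr /=.
  under [leqRHS]eq_bigr => S _ do rewrite capE.
  rewrite exchange_big /= mulnC -sum_nat_const.
  rewrite [leqRHS](bigID (mem J)) /=; apply: leq_trans (leq_addr _ _).
  apply: leq_sum => i iJ; rewrite -(weight_partial i pb).
  rewrite (bigID (mem (\bigcup_(j in J) N j))) /= [X in _ + X]big1 ?addn0 //.
  move=> S SN; have [->|mu_gt0] := posnP (mu i S); first by rewrite muln0.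
  by case/negP: SN; apply/bigcupP; exists i; rewrite ?inE.
have [f [fN fcap]] := hall_capacity hallN.
exists f; split=> [i|S sSX]; first by have := fN i; rewrite inE.
have total : \sum_S #|[set i | f i == S]| = \sum_S cap S.
  transitivity #|I|.
    rewrite -sum1_card (partition_big f predT) //=.
    apply: eq_bigr => S' _; rewrite -sum1_card; apply: eq_bigl => i.
    by rewrite inE.
  apply/eqP; rewrite -(eqn_pmul2l rX) [X in _ == X]big_distrr /=.
  under [X in _ == X]eq_bigr => S' _ do rewrite capE.
  rewrite exchange_big /= (eq_bigr (fun=> n - #|X|)) => [|i _]; last first.
    exact: weight_partial.
  by rewrite sum_nat_const mulnC.
have fcap_if S' (_ : true) :
    #|[set i | f i == S']| <= cap S' ?= iff (#|[set i | f i == S']| == cap S').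
  by split.
have [_] := leqif_sum fcap_if.
rewrite total eqxx => /esym/forallP/(_ S)/eqP ->.
by rewrite /cap sSX.
Qed.

(** One copy of [f i] becomes [z |: f i] in the i-th partial partition.  The
    identity [balance] expresses this without subtraction, so that sums of [mu']
    follow by adding. *)
Lemma partial_baranyaiU1 X mu z : partial_baranyai X mu -> z \notin X ->
  exists mu', partial_baranyai (z |: X) mu'.
Proof.
move=> pb zX; case: (pb) => suppX sizeX coverX countX.
have cardX : #|z |: X| = #|X|.+1 by rewrite cardsU1 zX.
have ltX : #|X| < n by rewrite -cardX max_card.
have [f [f_mu fcap]] := choose_extension pb ltX.
have fX i : f i \subset X := suppX _ _ (f_mu i).
have zf i : z \notin f i by apply: contra zX; apply/subsetP.
pose mu' i S := mu i S - (f i == S) + (z |: f i == S).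
have balance i S : mu' i S + (f i == S) = mu i S + (z |: f i == S).
  by rewrite /mu' addnAC subnK //; case: eqP => [<-|//]; apply: f_mu.
have sum_balance (P : pred {set T}) i :
    \sum_(S | P S) mu' i S + P (f i) = \sum_(S | P S) mu i S + P (z |: f i).
  have delta A : P A = \sum_(S | P S) (A == S) :> nat.
    rewrite -big_mkcondr /=.
    have [PA|nPA] := boolP (P A).
      rewrite (big_pred1 A) // => S; rewrite /= eq_sym.
      by case: eqP => [->|]; rewrite ?PA ?andbF.
    rewrite big_pred0 // => S.
    by case: (A =P S) => [<-|]; rewrite ?(negPf nPA) ?andbF.
  by rewrite !delta -!big_split /=; apply: eq_bigr => S _; apply: balance.
exists mu'; split.
- move=> i S; rewrite /mu'; case: (z |: f i =P S) => [<-|_].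
    by move=> _; apply: setUS.
  rewrite addn0 => /leq_trans/(_ (leq_subr _ _))/suppX sSX.
  exact: subset_trans sSX (subsetUr _ _).
- by move=> i; apply/eqP; rewrite -(eqn_add2r 1) (sum_balance predT) sizeX.
- move=> i x; rewrite !inE; have [->|nxz] := eqVneq x z => /= xX.
    have := sum_balance (fun S : {set T} => z \in S) i.
    rewrite /= setU11 (negPf (zf i)) addn0 => ->.
    rewrite big1 // => S zS; apply/eqP; rewrite -leqn0 leqNgt.
    by apply: contra zX => /suppX/subsetP; apply.
  have := sum_balance (fun S : {set T} => x \in S) i.
  by rewrite /= !inE (negPf nxz) /= coverX // => /addIn.
move=> S sSX; rewrite cardX.
have count_eq A : \sum_i (f i == A : nat) = #|[set i | f i == A]|.
  rewrite -sum1_card big_mkcond [RHS]big_mkcond; apply: eq_bigr => i _.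
  by rewrite inE; case: eqP.
have : \sum_i (mu' i S + (f i == S)) = \sum_i (mu i S + (z |: f i == S)).
  by apply: eq_bigr => i _; apply: balance.
rewrite !big_split /= count_eq.
have [zS|zS] := boolP (z \in S).
  have sSz : S :\ z \subset X.
    apply/subsetP => y; rewrite !inE => /andP[/negPf yz /(subsetP sSX)].
    by rewrite !inE yz.
  have -> : [set i | f i == S] = set0.
    by apply/setP => i; rewrite !inE; apply: contraNF (zf i) => /eqP ->.
  have -> : \sum_i mu i S = 0.
    apply: big1 => i _; apply/eqP; rewrite -leqn0 leqNgt.
    by apply: contra zX => /suppX/subsetP; apply.
  have shift i : (z |: f i == S) = (f i == S :\ z).
    by apply/eqP/eqP => [<-|->]; [rewrite setU1K | apply: setD1K].
  under [X in _ = _ + X -> _]eq_bigr => i _ do rewrite shift.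
  by rewrite cards0 addn0 add0n count_eq fcap // (cardsD1 z S) zS.
have sS : S \subset X.
  apply/subsetP => y yS; have := subsetP sSX _ yS; rewrite !inE.
  by case: eqP yS => // ->; rewrite (negPf zS).
rewrite [X in _ = _ + X]big1 => [|i _]; last first.
  by case: eqP zS => // <-; rewrite setU11.
rewrite addn0 countX // fcap // (ext_count_pascal _ ltX) => /eqP.
by rewrite eqn_add2r => /eqP.
Qed.

Lemma complete_baranyai : exists mu, partial_baranyai setT mu.
Proof.
suff H X : exists mu, partial_baranyai X mu by exact: H.
have [l] := ubnP #|X|; elim: l X => // l IH X ltl.
have [->|[z zX]] := set_0Vmem X; first by eexists; apply: partial_baranyai0.
have [|mu pb] := IH (X :\ z).
  by move: ltl; rewrite (cardsD1 z X) zX.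
have [|mu' pb'] := partial_baranyaiU1 pb (_ : z \notin X :\ z).
  by rewrite !inE eqxx.
by exists mu'; rewrite setD1K in pb'.
Qed.

(** When [X] is the whole of [T] the trace of a block is the block itself and
    [ext_count] is 1 on g-sets and 0 elsewhere, so the multiplicities are 0 or
    1 and each g-set is a block of exactly one partition. *)
Theorem baranyai : exists Q : I -> {set {set T}},
  [/\ forall i, partition (Q i) setT,
      forall i S, S \in Q i -> #|S| = g
    & forall S : {set T}, #|S| = g -> exists! i, S \in Q i].
Proof.
have [mu [_ sizeX coverX countX]] := complete_baranyai.
have sum_mu S : \sum_i mu i S = (#|S| == g).
  rewrite countX ?subsetT // /ext_count cardsT subnn.
  by case: ltngtP => // [lt|->]; rewrite ?subnn // bin0n subn_eq0 leqNgt lt.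
have mu_g i S : 0 < mu i S -> #|S| = g.
  move=> mu_gt0; apply/eqP; apply: contraTT mu_gt0 => /negPf Sg.
  by have /eqP := sum_mu S; rewrite Sg sum_nat_eq0 => /forallP/(_ i)/eqP ->.
exists (fun i => [set S | 0 < mu i S]); split.
- move=> i.
  have uniq_block x (S S' : {set T}) :
      x \in S -> x \in S' -> 0 < mu i S -> 0 < mu i S' -> S = S'.
    move=> xS xS' S0 S'0; apply/eqP; apply/negPn/negP => nSS'.
    have := coverX i x (in_setT _).
    rewrite (bigD1 S) //= (bigD1 S') /=; last first.
      by rewrite xS' eq_sym.
    by lia.
  apply/and3P; split.
  + rewrite eqEsubset subsetT; apply/subsetP => x _.
    have [/existsP[S /andP[xS S0]]|/existsPn no] :=
        boolP [exists S : {set T}, (x \in S) && (0 < mu i S)].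
      by apply/bigcupP; exists S; rewrite ?inE.
    have := coverX i x (in_setT _); rewrite big1 // => S xS.
    by apply/eqP; rewrite -leqn0 leqNgt; have := no S; rewrite xS.
  + apply/trivIsetP => S S'; rewrite !inE => S0 S'0 nSS'.
    rewrite -setI_eq0; apply/set0Pn => -[x /setIP[xS xS']].
    by case/eqP: nSS'; apply: (uniq_block x).
  + rewrite inE; apply/negP => /mu_g; rewrite cards0 => g0.
    by have := g_gt0; rewrite -g0.
- by move=> i S; rewrite inE => /mu_g.
move=> S Sg; have := sum_mu S; rewrite Sg eqxx => sum1.
have [i i0] : exists i, 0 < mu i S.
  have [/existsP//|/existsPn no] := boolP [exists i, 0 < mu i S].
  by move: sum1; rewrite big1 // => i _; apply/eqP; rewrite -leqn0 leqNgt.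
exists i; split; rewrite ?inE // => j; rewrite inE => j0.
apply/eqP/negPn/negP => nij.
move: sum1; rewrite (bigD1 i) //= (bigD1 j) //=; last first.
  by rewrite eq_sym.
by lia.
Qed.

End Baranyai.

(** * Arcs of a cycle *)

Section Arcs.
Local Open Scope nat_scope.

Lemma val_subZp m (i t : 'I_m.+3) :
  (i - t)%R = (if i < t then i + m.+3 - t else i - t) :> nat.
Proof.
have [it tt] := (ltn_ord i, ltn_ord t).
rewrite /= modnDmr; case: ltnP => le.
  by rewrite modn_small; lia.
by rewrite (_ : i + _ = i - t + m.+3) ?modnDr ?modn_small; lia.
Qed.

Variables (m h : nat).
Local Notation L := 'I_m.+3.

(** The [h] residues [a, a + 1, ...] modulo [m.+3].  With at least three
    residues, the ordinals form a ring in which [1] and [-1] differ. *)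
Definition arc (a : L) : {set L} := [set c : L | (c - a)%R < h].

Lemma arc_shift a c t : ((c + t)%R \in arc (a + t)%R) = (c \in arc a).
Proof. by rewrite !inE opprD addrACA subrr addr0. Qed.

(** For [2 <= h <= m.+3 - 2] a shift other than 0, 1 and -1 loses at least two
    elements, so consecutive arcs are recognized from the sizes of differences
    alone.  This is what makes the symmetries of a wreath dihedral. *)
Lemma arc_near a b : 1 < h -> h.+1 < m.+3 -> #|arc a :\: arc b| = 1 ->
  b = (a + 1)%R \/ b = (a - 1)%R.
Proof.
move=> h_gt1 h_lt1.
have [t ->] : exists t, b = (a + t)%R.
  by exists (b - a)%R; rewrite addrCA subrr addr0.
have tt := ltn_ord t.
have [t0|t0] := eqVneq (t : nat) 0.
  have -> : t = 0%R by apply: val_inj.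
  by rewrite addr0 setDv cards0.
have [t1|t1] := eqVneq (t : nat) 1.
  by left; congr (_ + _)%R; apply: val_inj.
have [tm|tm] := eqVneq (t : nat) m.+2.
  by right; congr (_ + _)%R; apply: val_inj; rewrite /= tm modn_small.
(* Element [a + i] is lost by the shift iff [t + h - m.+3 <= i < minn t h], an
   interval of length at least 2; [i0] is its first element. *)
pose i0 := t + h - m.+3.
have i0lt : i0.+1 < m.+3 by rewrite /i0; lia.
have inD i (lti : i < m.+3) : i0 <= i <= i0.+1 ->
    (a + Ordinal lti)%R \in arc a :\: arc (a + t)%R.
  move=> ii; rewrite !inE opprD addrA [(a + _)%R]addrC addrK -leqNgt.
  rewrite val_subZp /=; move: ii; rewrite /i0; case: ltnP; lia.
move=> card1.
have /card_le1_eqP/(_ _ _ (inD i0 (ltnW i0lt) _) (inD i0.+1 i0lt _)) :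
    #|arc a :\: arc (a + t)%R| <= 1 by rewrite card1.
rewrite !leqnn leqnSn => /(_ isT isT)/addrI/(congr1 val)/=; lia.
Qed.

Hypotheses (h_gt0 : 0 < h) (h_lt : h < m.+3).

Lemma card_arc a : #|arc a| = h.
Proof.
have -> : arc a = [set (widen_ord (ltnW h_lt) i + a)%R | i : 'I_h].
  apply/setP => c; apply/idP/imsetP => [|[i _ ->]]; rewrite inE ?addrK.
    move=> ca; exists (Ordinal ca); rewrite // -[LHS](subrK a).
    by congr (_ + _)%R; apply: val_inj.
  exact: ltn_ord i.
rewrite card_imset ?card_ord // => i j /addIr/(congr1 val)/= ij.
exact: val_inj.
Qed.

Lemma arcD_succ a : arc a :\: arc (a + 1)%R = [set a].
Proof.
apply/setP => c; rewrite !inE opprD addrA -leqNgt -subr_eq0.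
move: (c - a)%R => u; rewrite val_subZp -val_eqE /= [1 %% _]modn_small //.
by case: u => u u_lt /=; case: ltnP; lia.
Qed.

Lemma arc_inj : injective arc.
Proof.
move=> a b ab; apply/set1_inj; rewrite -!arcD_succ ab; congr (_ :\: _).
by apply/setP => c; rewrite -(subrK 1%R c) !arc_shift ab.
Qed.

End Arcs.

(** * Permutations matching two labellings *)

Section Relabel.
Local Open Scope nat_scope.

(** The lists of values of [l1] and [l2] are permutations of each other. *)
Lemma relabel n (L : eqType) (l1 l2 : 'I_n -> L) :
  (forall a, #|[set x | l1 x == a]| = #|[set x | l2 x == a]|) ->
  exists pi : {perm 'I_n}, forall x, l2 (pi x) = l1 x.
Proof.
move=> card_eq.
have countE (l : 'I_n -> L) a :
    count_mem a [tuple l i | i < n] = #|[set x | l x == a]|.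
  by rewrite /= count_map cardsE cardE -size_filter enumT /enum_mem size_filter.
have /tuple_permP[pi /val_inj/= piE] :
    perm_eq [tuple l1 i | i < n] [tuple l2 i | i < n].
  by apply/allP => a _ /=; rewrite !countE card_eq.
exists pi => x; have := congr1 (fun t => tnth t x) piE.
by rewrite !tnth_mktuple.
Qed.

End Relabel.

(** * Wreaths as an orbit of the symmetric group *)

Section Wreaths.
Local Open Scope nat_scope.
Variables (n k m h g : nat).
Local Notation L := 'I_m.+3.
Hypotheses (g_gt0 : 0 < g) (h_gt0 : 0 < h) (h_lt : h < m.+3).
Hypotheses (h_co : coprime m.+3 h) (nE : n = m.+3 * g) (kE : k = h * g).
Local Notation T := 'I_n.

(** [label x] is the index of the run of length [g] containing [x]. *)
Definition label (x : T) : L := (x %/ g)%:R%R.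
Definition labelled (A : {set L}) : {set T} := label @^-1: A.
Definition seg (j : L) : {set T} := labelled (arc h j).
(** Up to the cyclic shift by one, the wreath of the identity. *)
Definition base : {set {set T}} := [set seg j | j : L].

Local Notation sact := ('P^* )%act.
Local Notation famact := ('P^*^* )%act.

Lemma sactE (A : {set T}) (s : {perm T}) : sact A s = s @: A.
Proof. by []. Qed.

Lemma famactE (F : {set {set T}}) (s : {perm T}) :
  famact F s = [set s @: B | B : {set T} in F].
Proof. by []. Qed.

Lemma val_natr (a : nat) : (a%:R%R : L) = a %% m.+3 :> nat.
Proof. by rewrite Zp_nat. Qed.

Lemma val_label (x : T) : label x = x %/ g :> nat.
Proof.
rewrite /label val_natr modn_small // ltn_divLR //.
by have := ltn_ord x; rewrite {2}nE.
Qed.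

Lemma card_label (c : L) : #|[set x | label x == c]| = g.
Proof.
have lt r : r < g -> c * g + r < n.
  by move=> rg; rewrite nE; have := ltn_ord c; nia.
pose f (r : 'I_g) : T := Ordinal (lt r (ltn_ord r)).
have -> : [set x | label x == c] = [set f r | r : 'I_g].
  apply/setP => x; rewrite inE; apply/eqP/imsetP => [xc|[r _ ->]].
    exists (Ordinal (ltn_pmod x g_gt0)) => //; apply: val_inj => /=.
    by rewrite -xc val_label -divn_eq.
  by apply: val_inj; rewrite /= val_label /= divnMDl // divn_small ?addn0.
rewrite card_imset ?card_ord // => r r' /(congr1 val)/= /addnI rr'.
exact: val_inj.
Qed.

Lemma card_labelled A : #|labelled A| = #|A| * g.
Proof.
rewrite -sum1_card (partition_big label (mem A)) /=; last first.
  by move=> x; rewrite inE.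
rewrite -sum_nat_const; apply: eq_bigr => c cA.
rewrite -[RHS](card_label c) -sum1_card; apply: eq_bigl => x; rewrite !inE.
by case: eqP => [->|]; rewrite ?andbF ?cA.
Qed.

Lemma label_surj c : exists x, label x = c.
Proof.
have /card_gt0P[x] : 0 < #|[set x | label x == c]| by rewrite card_label.
by rewrite inE => /eqP; exists x.
Qed.

Lemma labelled_inj : injective labelled.
Proof.
move=> A B AB; apply/setP => c; have [x <-] := label_surj c.
by have /setP/(_ x) := AB; rewrite !inE.
Qed.

Lemma seg_inj : injective seg.
Proof. by move=> i j /labelled_inj/arc_inj; apply. Qed.

Lemma card_seg j : #|seg j| = k.
Proof. by rewrite card_labelled card_arc // kE. Qed.

Lemma card_base : #|base| = m.+3.
Proof. by rewrite card_imset ?card_ord //; apply: seg_inj. Qed.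

Lemma card_segD i j : #|seg i :\: seg j| = #|arc h i :\: arc h j| * g.
Proof. by rewrite /seg /labelled -preimsetD card_labelled. Qed.

Lemma seg_near i j : 1 < h -> h.+1 < m.+3 -> #|seg i :\: seg j| = g ->
  j = (i + 1)%R \/ j = (i - 1)%R.
Proof.
move=> h1 h2; rewrite card_segD -{2}[g]mul1n => /eqP.
by rewrite eqn_pmul2r // => /eqP; apply: arc_near.
Qed.

Lemma card_segD1 i : #|seg i :\: seg (i + 1)%R| = g.
Proof. by rewrite card_segD arcD_succ // cards1 mul1n. Qed.

(** Such a permutation is given by its restrictions to the [m.+3] runs. *)
Lemma card_label_preserving :
  #|[set s : {perm T} | [forall x, label (s x) == label x]]| <= g`! ^ m.+3.
Proof.
set K := [set _ | _].
pose P c := [set x | label x == c].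
pose f (s : {perm T}) : {ffun L -> {perm T}} := [ffun c => restr_perm (P c) s].
have sP s x : s \in K -> label (s x) = label x.
  by rewrite inE => /forallP/(_ x)/eqP.
have sN s c : s \in K -> s \in ('N(P c | 'P))%g.
  by move=> sK; apply/astabsP => x; rewrite /= !inE /aperm sP.
have f_inj : {in K &, injective f}.
  move=> s s' sK s'K ff; apply/permP => x.
  have := congr1 (fun F : {ffun L -> {perm T}} => F (label x) x) ff.
  by rewrite !ffunE !restr_permE ?sN // inE eqxx.
rewrite -(card_in_imset f_inj).
have -> : g`! ^ m.+3 = #|family (fun c => perm_on (P c))|.
  rewrite card_family foldrE big_map big_enum /=.
  rewrite (eq_bigr (fun=> g`!)) ?prod_nat_const ?card_ord // => c _.
  by rewrite card_perm card_label.
apply/subset_leq_card/subsetP => F /imsetP[s sK ->].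
by apply/familyP => c; rewrite ffunE; apply: restr_perm_on.
Qed.

Lemma stab_base_seg (s : {perm T}) j :
  s \in ('C[base | famact])%g -> exists i, s @: seg j = seg i.
Proof.
move=> /astab1P; rewrite famactE => sb.
have : s @: seg j \in base by rewrite -sb !imset_f.
by case/imsetP=> i _ ->; exists i.
Qed.

Lemma imsetD_perm (s : {perm T}) (A B : {set T}) :
  s @: (A :\: B) = (s @: A) :\: (s @: B).
Proof.
apply/setP => y; rewrite -(permKV s y) !inE !(mem_imset _ _ (@perm_inj _ s)).
by rewrite inE.
Qed.

Lemma stab_near (s : {perm T}) i j i' j' : 1 < h -> h.+1 < m.+3 ->
  s @: seg i = seg i' -> s @: seg j = seg j' -> j = (i + 1)%R ->
  j' = (i' + 1)%R \/ j' = (i' - 1)%R.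
Proof.
move=> h1 h2 si sj ji; apply: seg_near => //.
by rewrite -si -sj -imsetD_perm card_imset ?ji ?card_segD1 //; apply: perm_inj.
Qed.

(** Moving along the cycle: the image of a segment is a neighbour of the image
    of the previous one, and by injectivity it is not the one before that. *)
Lemma stab_two_segs (s : {perm T}) : 1 < h -> h.+1 < m.+3 ->
  s \in ('C[base | famact])%g -> s @: seg 0%R = seg 0%R ->
  s @: seg 1%R = seg 1%R -> forall j, s @: seg j = seg j.
Proof.
move=> h1 h2 sC s0 s1.
have H (a : nat) :
    s @: seg a%:R%R = seg a%:R%R /\ s @: seg a.+1%:R%R = seg a.+1%:R%R.
  elim: a => [|a [IH1 IH2]]; first by split.
  split=> //; have [i si] := stab_base_seg a.+2%:R%R sC.
  have [|iE|iE] := stab_near h1 h2 IH2 si.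
  - by rewrite [in LHS]mulrSr.
  - by rewrite si iE -mulrSr.
  have : a.+2%:R%R = a%:R%R :> L.
    apply: seg_inj; apply: (imset_inj (@perm_inj _ s)).
    by rewrite si IH1 iE [a.+1%:R%R]mulrSr addrK.
  by rewrite -[a.+2]addn2 natrD -[RHS]addr0 => /addrI.
by move=> j; have [+ _] := H j; rewrite natr_Zp.
Qed.

(** The run [c] is the difference of the segments starting at
    [c] and [c + 1]. *)
Lemma label_fixed (s : {perm T}) :
  (forall j, s @: seg j = seg j) -> forall x, label (s x) = label x.
Proof.
move=> ss x; pose c := label x.
have : x \in seg c :\: seg (c + 1)%R.
  by rewrite /seg /labelled -preimsetD inE arcD_succ // inE.
rewrite -(mem_imset _ _ (@perm_inj _ s)) imsetD_perm !ss.
by rewrite /seg /labelled -preimsetD inE arcD_succ // inE => /eqP.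
Qed.

(** Apply the orbit-stabilizer theorem twice: the first segment has at most
    [m.+3] images, the second one is then next to it, hence has at most two, and
    a permutation fixing both fixes all segments, hence every run. *)
Lemma card_stab_base : 1 < h -> h.+1 < m.+3 ->
  #|('C[base | famact])%g| <= 2 * m.+3 * g`! ^ m.+3.
Proof.
move=> h1 h2.
set G := ('C[base | famact])%G.
have orb0 : #|orbit sact G (seg 0%R)| <= m.+3.
  rewrite -card_base; apply/subset_leq_card/subsetP => A /orbitP[s sG <-].
  by rewrite sactE; have [i ->] := stab_base_seg 0%R sG; apply: imset_f.
set H := ('C_G[seg 0%R | sact])%G.
have orb1 : #|orbit sact H (seg 1%R)| <= 2.
  apply: leq_trans (_ : #|[set seg 1%R; seg (-1)%R]| <= 2); last first.
    by rewrite cards2; case: eqP.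
  apply/subset_leq_card/subsetP => A /orbitP[s /setIP[sG /astab1P]].
  rewrite sactE => s0 <-; rewrite sactE.
  have [i si] := stab_base_seg 1%R sG.
  have := stab_near h1 h2 s0 si; rewrite si !add0r !inE => /(_ erefl).
  by case=> ->; rewrite eqxx ?orbT.
have := card_orbit_stab sact G (seg 0%R); rewrite -/H => <-.
have := card_orbit_stab sact H (seg 1%R) => <-.
rewrite mulnA (mulnC 2) !leq_mul //.
apply: leq_trans card_label_preserving.
apply/subset_leq_card/subsetP => s /setIP[/setIP[sG /astab1P s0] /astab1P s1].
rewrite inE; apply/forallP => x; apply/eqP/label_fixed.
by apply: stab_two_segs => //; rewrite -sactE.
Qed.

(** Blocks start at multiples of [k], which advance by [h] runs at a time, and
    at position one: whence the product [i * h] and the successor [ordS]. *)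
Lemma wreath_position (i x : T) :
  [exists j : 'I_k, ordS x == i * k + j.+1 %[mod n]] = (x \in seg (i * h)%:R%R).
Proof.
have n_gt0 : 0 < n by apply: leq_ltn_trans (ltn_ord x).
have shiftE (j : 'I_k) :
    (ordS x == i * k + j.+1 %[mod n]) = (x == i * k + j %[mod n]).
  by rewrite /= modn_mod addnS -[x.+1]addn1 -[(_ + j).+1]addn1 eqn_modDr.
rewrite !inE; apply/existsP/idP => [[j]|cx].
  rewrite shiftE modn_small // => /eqP.
  move: (nat_of_ord j) (ltn_ord j) => {}j jk xE.
  have -> : label x = ((i * h)%:R + (j %/ g)%:R)%R.
    rewrite -natrD; apply: val_inj.
    rewrite [LHS]val_label [RHS]val_natr xE {2}nE.
    rewrite -modn_divl.
    by rewrite kE mulnA divnMDl.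
  rewrite addrAC subrr add0r val_natr.
  apply: leq_ltn_trans (leq_mod _ _) _.
  by rewrite ltn_divLR // -kE.
set c := (label x - _)%R in cx.
have jk : c * g + x %% g < k.
  by rewrite kE; have := ltn_pmod x g_gt0; nia.
exists (Ordinal jk); rewrite shiftE /= {1}(divn_eq x g).
have -> : x %/ g = (i * h + c) %% m.+3.
  rewrite -val_natr -val_label; congr (nat_of_ord _).
  by rewrite natrD natr_Zp /c addrCA subrr addr0.
by rewrite addnA kE mulnA -mulnDl muln_modl -nE modnDml.
Qed.

(** As [h] is a unit modulo [m.+3], every run is the start of a block. *)
Lemma mul_h_surj (u : L) : exists i : T, (i * h)%:R%R = u.
Proof.
have h_unit : (h%:R%R : 'Z_m.+3) \is a GRing.unit by rewrite unitZpE.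
pose u' : 'Z_m.+3 := (u / h%:R)%R.
have lt : u' < n.
  by apply: leq_trans (ltn_ord u') _; rewrite nE leq_pmulr.
exists (Ordinal lt); rewrite [nat_of_ord _]/= natrM.
have -> : (u'%:R)%R = u' :> L by apply: natr_Zp.
exact: divrK.
Qed.

Lemma wreath_of_act (pi : {perm T}) :
  wreath_of k pi = famact base (perm (@ordS_inj n) * pi)%g.
Proof.
have blockE i : wreath_block k pi i =
    (perm (@ordS_inj n) * pi)%g @: seg (i * h)%:R%R.
  apply/setP => y; apply/imsetP/imsetP => [[x + ->]|[x xi ->]].
    rewrite inE -(ord_predK x) wreath_position => xi.
    by exists (ord_pred x); rewrite // permM permE.
  by exists (ordS x); rewrite ?inE ?wreath_position // permM permE.
apply/setP => A; apply/imsetP/imsetP => [[i _ ->]|[_ /imsetP[u _ ->] ->]].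
  by exists (seg (i * h)%:R%R); rewrite ?blockE ?imset_f.
by have [i <-] := mul_h_surj u; exists i; rewrite ?blockE.
Qed.

Lemma wreathsE : wreaths n k = orbit famact setT base.
Proof.
apply/setP => F; apply/imsetP/orbitP => [[pi _ ->]|[s _ <-]].
  by eexists; [|rewrite wreath_of_act]; rewrite ?inE.
exists ((perm (@ordS_inj n))^-1 * s)%g => //.
by rewrite wreath_of_act mulKVg.
Qed.

Lemma wreathP F :
  reflect (exists s : {perm T}, F = [set s @: seg j | j : L])
          (F \in wreaths n k).
Proof.
have actE s : famact base s = [set s @: seg j | j : L].
  by rewrite famactE -imset_comp.
rewrite wreathsE; apply: (iffP orbitP) => [[s _ <-]|[s ->]]; exists s => //.
Qed.

Lemma card_wreath F : F \in wreaths n k -> #|F| = m.+3.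
Proof.
case/wreathP=> s ->; rewrite card_imset ?card_ord // => i j.
by move/(imset_inj (@perm_inj _ s))/seg_inj.
Qed.

Lemma wreath_sub F A : F \in wreaths n k -> A \in F -> A \in ksubsets n k.
Proof.
case/wreathP=> s -> /imsetP[j _ ->]; rewrite inE card_imset ?card_seg //.
exact: perm_inj.
Qed.

Definition degree (A : {set T}) := #|[set F in wreaths n k | A \in F]|.

Lemma degree_act (s : {perm T}) (A : {set T}) : degree (s @: A) = degree A.
Proof.
rewrite /degree -(card_imset [set F : {set {set T}} in _ | A \in F]
  (@act_inj _ _ _ famact s)).
congr #|pred_of_set _|; apply/setP => F; rewrite -(actKV famact s F).
rewrite (mem_imset _ _ (@act_inj _ _ _ famact s)) !inE.
rewrite famactE (mem_imset _ _ (imset_inj (@perm_inj _ s))); congr (_ && _).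
by rewrite wreathsE -famactE (orbit_actr famact) ?inE.
Qed.

Lemma perm_ksubset (A B : {set T}) :
  #|A| = #|B| -> exists s : {perm T}, s @: A = B.
Proof.
move=> AB; have [a|s sE] := @relabel n bool (mem A) (mem B).
  have fiber (C : {set T}) b : [set x | mem C x == b] = if b then C else ~: C.
    by apply/setP => x; case: b; rewrite !inE ?eqb_id // eqbF_neg.
  by rewrite !fiber; case: a => //; rewrite [LHS]cardsCs [RHS]cardsCs !setCK AB.
exists s; apply/setP => y; rewrite -(permKV s y).
rewrite mem_imset; last exact: perm_inj.
by have /= -> := sE (s^-1 y)%g.
Qed.

Lemma degree_count (A : {set T}) :
  #|A| = k -> 'C(n, k) * degree A = #|wreaths n k| * m.+3.
Proof.
move=> Ak.
have -> : #|wreaths n k| * m.+3 = \sum_(F in wreaths n k) #|F|.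
  by rewrite -sum_nat_const; apply: eq_bigr => F /card_wreath.
rewrite -{1}[n]card_ord -card_draws -sum_nat_const.
rewrite (eq_bigr degree) => [|B]; last first.
  rewrite inE => /eqP Bk; have [s <-] := perm_ksubset (etrans Ak (esym Bk)).
  by rewrite degree_act.
rewrite /degree; under eq_bigr => B _ do rewrite -sum1_card.
rewrite (exchange_big_dep (mem (wreaths n k))) /=; last first.
  by move=> B F _; rewrite inE => /andP[].
apply: eq_bigr => F FW; rewrite -sum1_card; apply: eq_bigl => B.
by rewrite !inE FW /= andb_idl // => /(wreath_sub FW); rewrite inE.
Qed.

Lemma leq_k_n : k <= n.
Proof. by rewrite kE nE leq_mul2r (ltnW h_lt) orbT. Qed.

Lemma card_wreaths_gt0 : 0 < #|wreaths n k|.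
Proof.
by apply/card_gt0P; exists (wreath_of k 1%g); apply: imset_f.
Qed.

Lemma degree_gt0 (A : {set T}) : #|A| = k -> 0 < degree A.
Proof.
move=> Ak; have := degree_count Ak; rewrite lt0n; case: eqP => // ->.
by have := card_wreaths_gt0; lia.
Qed.

(** By double counting, [degree A] is [n! * m.+3] divided by ['C(n, k)] and the
    order of the stabilizer of [base]. *)
Lemma degree_ge (A : {set T}) : #|A| = k -> 1 < h -> h.+1 < m.+3 ->
  (n - k)`! * k`! <= degree A * (2 * g`! ^ m.+3).
Proof.
move=> Ak h1 h2; have C_gt0 : 0 < 'C(n, k) by rewrite bin_gt0 leq_k_n.
rewrite -(leq_pmul2l C_gt0) [(n - k)`! * _]mulnC bin_fact ?leq_k_n //.
rewrite mulnA degree_count //.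
have := card_orbit_stab famact [set: {perm T}]%G base.
rewrite -wreathsE setTI cardsT card_Sn => <-.
rewrite -mulnA leq_mul2l; apply/orP; right.
by apply: leq_trans (card_stab_base _ _) _; lia.
Qed.
Lemma other_same_label (x : T) : 1 < g -> exists2 z, label z = label x & z != x.
Proof.
move=> g1; have : 0 < #|[set z | label z == label x] :\ x|.
  by have := card_label (label x); rewrite (cardsD1 x) !inE eqxx; lia.
by case/card_gt0P=> z; rewrite !inE => /andP[zx /eqP]; exists z.
Qed.

Lemma in_seg (x : T) j : (x \in seg j) = (label x \in arc h j).
Proof. by rewrite inE. Qed.

(** The swap brings [x] into the segment and takes [y] out.  If [g > 1] the
    result contains [x] without the rest of its run.  If [g = 1] it differs from
    [seg 1] by one point, so it could only be [seg 0] or [seg 2]; but it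
    misses [y], which is in [seg 0], and contains [x], which is not in
    [seg 2]. *)
Lemma swap_not_seg (x y : T) (j : L) : y \in seg 1%R -> x \notin seg 1%R ->
  (1 < g) || [&& 1 < h, h.+1 < m.+3 & label x == 0%R] -> label y = 1%R ->
  tperm x y @: seg 1%R != seg j.
Proof.
move=> y1 x1 gh ly; apply/eqP => sj.
have xj : x \in seg j.
  by rewrite -sj -[x in x \in _](tpermR x y) imset_f.
have yj : y \notin seg j.
  rewrite -sj -[y in y \notin _](tpermL x y) mem_imset //; exact: perm_inj.
have [g1|g1] := ltnP 1 g.
  have [z lz zx] := other_same_label x g1.
  have z1 : z \notin seg 1%R by rewrite in_seg lz -in_seg.
  have zy : z != y by apply: contraNneq z1 => ->.
  have : z \in seg j by rewrite in_seg lz -in_seg.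
  have -> : z = tperm x y z by rewrite tpermD // eq_sym.
  by rewrite -sj mem_imset ?(negPf z1) //; apply: perm_inj.
move: gh; rewrite ltnNge g1 /= => /and3P[h1 h2 /eqP lx].
have gE : g = 1 by lia.
have : #|seg 1%R :\: seg j| = g.
  suff -> : seg 1%R :\: seg j = [set y] by rewrite cards1 gE.
  apply/setP => z; rewrite in_setD in_set1.
  have [->|zy] := eqVneq z y; first by rewrite y1 yj.
  apply/negP => /andP[zj z1]; have zx : z != x by apply: contraTneq z1 => ->.
  case/negP: zj; have -> : z = tperm x y z by rewrite tpermD // eq_sym.
  by rewrite -sj imset_f.
case/(seg_near h1 h2) => jE.
  by move: xj; rewrite in_seg inE lx jE val_subZp /= !modn_small; lia.
by move: yj; rewrite in_seg inE ly jE subrr subr0 /= modn_small // h1.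
Qed.

(** A transposition of two points that are both in the first segment, or both
    outside of it, keeps that segment but moves the next one off [base]. *)
Lemma wreaths_overlap : 1 < k -> (1 < g) || (h.+1 < m.+3) ->
  exists F F' : {set {set T}}, [/\ F \in wreaths n k, F' \in wreaths n k,
    F != F' & exists A, A \in F :&: F'].
Proof.
move=> k1 gh.
(* For [h = 1], runs 1 and 2 are both outside the first segment; this is where
   three runs are required. *)
have [x lx] := label_surj (if 1 < h then 0%R else 2%:R%R).
have [y ly] := label_surj 1%R.
have y1 : y \in seg 1%R by rewrite in_seg ly inE subrr.
have x1 : x \notin seg 1%R.
  rewrite in_seg lx inE val_subZp; case: (ltnP 1 h) => h1 /=.
    by rewrite modn_small; lia.
  by rewrite !modn_small; lia.
have h_or : h = 1 \/ 1 < h by lia.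
have xy0 : (x \in seg 0%R) = (y \in seg 0%R).
  rewrite !in_seg lx ly !inE !subr0; case: h_or => [->|h1]; last by rewrite h1.
  by [].
have s0 : tperm x y @: seg 0%R = seg 0%R.
  apply/eqP; rewrite eqEcard card_imset ?leqnn ?andbT; last exact: perm_inj.
  apply/subsetP => _ /imsetP[z z0 ->].
  by case: tpermP z0 => // ->; rewrite xy0.
have gh' : (1 < g) || [&& 1 < h, h.+1 < m.+3 & label x == 0%R].
  case/orP: gh => [->//|h2]; case: (ltnP 1 g) => //= g1.
  have h1 : 1 < h by move: k1; rewrite kE; nia.
  by rewrite h1 h2 lx h1 eqxx.
exists base, [set tperm x y @: seg j | j : L]; split.
- rewrite wreathsE; exact: orbit_refl.
- by apply/wreathP; exists (tperm x y).
- apply/eqP => bE.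
  have : tperm x y @: seg 1%R \in base by rewrite bE imset_f.
  by case/imsetP=> j _ /eqP; apply/negP; apply: swap_not_seg.
exists (seg 0%R); rewrite inE imset_f //= -{1}s0; exact: imset_f.
Qed.

(** Match the label of a point with the block that contains it. *)
Lemma partition_labelled (Q : {set {set T}}) :
  partition Q setT -> (forall A, A \in Q -> #|A| = g) ->
  exists s : {perm T}, Q = [set s @: labelled [set c] | c : L].
Proof.
move=> parQ Qg; have trivQ := partition_trivIset parQ.
have cardQ : #|Q| = m.+3.
  have := card_uniform_partition Qg parQ.
  rewrite cardsT card_ord => Qn; apply/eqP.
  by rewrite -(eqn_pmul2r g_gt0) -Qn nE.
pose blk (c : L) := nth set0 (enum Q) c.
have blkQ c : blk c \in Q by rewrite -mem_enum mem_nth // -cardE cardQ.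
have blk_inj : injective blk.
  move=> c d /eqP; rewrite nth_uniq ?enum_uniq -?cardE ?cardQ //.
  by move=> /eqP/val_inj.
have blkE A : A \in Q -> exists c, A = blk c.
  rewrite -mem_enum => AQ; have lt : index A (enum Q) < m.+3.
    by rewrite -cardQ cardE index_mem.
  by exists (Ordinal lt); rewrite /blk /= nth_index.
have inQ x : pblock Q x \in Q.
  by rewrite pblock_mem // (cover_partition parQ).
have [A|s sE] := @relabel n _ (fun x => blk (label x)) (pblock Q).
  have [AQ|AQ] := boolP (A \in Q).
    have [c ->] := blkE _ AQ; rewrite -[RHS]/(#|_|).
    have -> : [set x | blk (label x) == blk c] = [set x | label x == c].
      by apply/setP => x; rewrite !inE (inj_eq blk_inj).
    rewrite card_label -(Qg (blk c)) //; congr #|pred_of_set _|.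
    apply/setP => x; rewrite inE; apply/idP/eqP => [xc|<-].
      exact: def_pblock.
    by rewrite mem_pblock (cover_partition parQ).
  rewrite !eq_card0 // => x; rewrite !inE; apply: contraNF AQ => /eqP <- //.
exists s; apply/setP => A.
have sblk c : s @: labelled [set c] = blk c.
  apply/setP => y; rewrite -(permKV s y) mem_imset; last exact: perm_inj.
  move: (s^-1 y)%g => z; rewrite !inE -(inj_eq blk_inj) -sE.
  apply/eqP/idP => [<-|]; first by rewrite mem_pblock (cover_partition parQ).
  exact: def_pblock.
apply/idP/imsetP => [/blkE[c ->]|[c _ ->]]; last by rewrite sblk.
by exists c.
Qed.

(** For [h = 1] the segments are the runs, so every partition into g-sets is a
    wreath; for [h.+1 = m.+3] they are the complements of the runs, and [phi]
    is complementation.  In both cases Baranyai's theorem applies. *)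
Lemma decomposable_extreme : h = 1 \/ h.+1 = m.+3 -> wreath_decomposable n k.
Proof.
move=> h_ext.
have [phi [phi_inj card_phi phi_wreath]] : exists phi : {set T} -> {set T},
    [/\ involutive phi, forall A, (#|phi A| == k) = (#|A| == g)
      & forall Q, partition Q setT -> (forall A, A \in Q -> #|A| = g) ->
          phi @: Q \in wreaths n k].
  case: h_ext => hE.
    exists id; split=> // [A|Q parQ Qg]; first by rewrite kE hE mul1n.
    have [s ->] := partition_labelled parQ Qg; rewrite imset_id.
    apply/wreathP; exists s; apply: eq_imset => c; congr (_ @: _).
    rewrite /seg; congr labelled; apply/setP => d; rewrite !inE hE ltnS leqn0.
    by rewrite -[LHS]subr_eq0 -val_eqE.
  exists (@setC T); split=> [|A|Q parQ Qg]; first exact: setCK.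
    have nkg : n = k + g by rewrite kE nE -hE mulSn addnC.
    have := max_card (mem A); rewrite cardsCs setCK card_ord.
    by move: #|A| nkg => a; lia.
  have [s ->] := partition_labelled parQ Qg; apply/wreathP; exists s.
  have segE c : s @: seg (c + 1)%R = ~: (s @: labelled [set c]).
    have -> : seg (c + 1)%R = ~: labelled [set c].
      apply/setP => x; rewrite !inE opprD addrA -[RHS]/(_ != _) -subr_eq0.
      move: (label x - c)%R => u.
      rewrite val_subZp -val_eqE /= [1 %% _]modn_small //.
      by case: u => u u_lt /=; case: (ltnP u 1); lia.
    apply/setP => y; rewrite -(permKV s y) inE !mem_imset; try exact: perm_inj.
    by rewrite inE.
  rewrite -imset_comp; apply/setP => A.
  apply/imsetP/imsetP => [[c _ ->]|[c _ ->]].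
    by exists (c + 1)%R; rewrite // segE.
  by exists (c - 1)%R; rewrite //= -segE subrK.
have cardT : #|T| = m.+3 * g by rewrite card_ord.
have [Q [parQ Qg Quniq]] := baranyai g_gt0 cardT.
have mem_phi (A : {set T}) (P : {set {set T}}) :
    (A \in phi @: P) = (phi A \in P).
  by rewrite -{1}(phi_inj A) mem_imset //; apply: inv_inj.
exists [set phi @: Q i | i : 'I_('C(#|T|.-1, g.-1))]; split.
- by apply/subsetP => _ /imsetP[i _ ->]; apply: phi_wreath (Qg i).
- apply/trivIsetP => _ _ /imsetP[i _ ->] /imsetP[j _ ->] ij.
  rewrite -setI_eq0; apply/set0Pn => -[A]; rewrite inE !mem_phi => /andP[Ai Aj].
  have [l [_ l_uniq]] := Quniq _ (Qg _ _ Ai).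
  by case/eqP: ij; rewrite -(l_uniq i) // -(l_uniq j).
apply/setP => A; rewrite inE; apply/bigcupP/idP => [[_ /imsetP[i _ ->]]|Ak].
  by rewrite mem_phi => /Qg/eqP; rewrite -card_phi phi_inj.
have [|i [iA _]] := Quniq (phi A).
  by apply/eqP; rewrite -card_phi phi_inj.
by exists (phi @: Q i); rewrite ?mem_phi // imset_f.
Qed.
End Wreaths.

(** * The kernel of the wreath matrix *)

Section Kernel.
Local Open Scope ring_scope.
Variables (R : realType) (n k : nat).
Implicit Types v : 'cV[R]_#|wreaths n k|.

Lemma wreath_in (j : 'I_#|wreaths n k|) : wreath j \in wreaths n k.
Proof. exact: enum_valP. Qed.

Lemma mulmx_wreath v i :
  (wreath_matrix R n k *m v) i 0 =
  \sum_(A in wreath i) \sum_(j | A \in wreath j) v j 0.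
Proof.
rewrite mxE (exchange_big_dep predT) //=; apply: eq_bigr => j _.
rewrite mxE -sum1_card natr_sum mulr_suml.
by apply: eq_big => [A|A _]; rewrite ?inE ?mul1r.
Qed.

(** For [v] in the kernel, expand [v^T * M * v = 0] over the common members of
    two wreaths: it is the sum of the squares of the sums on the right. *)
Lemma in_kerP v :
  in_ker (wreath_matrix R n k) v <->
  forall A : {set 'I_n}, \sum_(j | A \in wreath j) v j 0 = 0.
Proof.
split=> [Mv0 A|sum0]; last first.
  by apply/colP => i; rewrite mulmx_wreath mxE big1.
have sq0 : \sum_A (\sum_(j | A \in wreath j) v j 0) ^+ 2 = 0.
  transitivity (\sum_i v i 0 * (wreath_matrix R n k *m v) i 0); last first.
    by rewrite Mv0 big1 // => i _; rewrite mxE mulr0.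
  under [RHS]eq_bigr => i _ do rewrite mulmx_wreath mulr_sumr.
  rewrite (exchange_big_dep predT) //=; apply: eq_bigr => B _.
  by rewrite expr2 mulr_suml.
have /(_ predT sq0) := psumr_eq0P
  (fun (B : {set 'I_n}) _ => sqr_ge0 (\sum_(j | B \in wreath j) v j 0)).
by move=> /(_ A isT)/eqP; rewrite sqrf_eq0 => /eqP.
Qed.

Lemma in_kerN v : in_ker (wreath_matrix R n k) v ->
  in_ker (wreath_matrix R n k) (- v).
Proof. by rewrite /in_ker mulmxN => ->; rewrite oppr0. Qed.

Lemma degree_index (A : {set 'I_n}) :
  degree k A = #|[set j : 'I_#|wreaths n k| | A \in wreath j]|.
Proof.
rewrite -(card_imset _ (@enum_val_inj _ (mem (wreaths n k)))).
congr #|pred_of_set _|; apply/setP => F; rewrite inE.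
apply/andP/imsetP => [[FW AF]|[j]]; last first.
  by rewrite inE => Aj ->; split=> //; apply: enum_valP.
by exists (enum_rank_in FW F); rewrite ?inE /wreath enum_rankK_in.
Qed.

(** Otherwise the entries at the wreaths containing [A] are nonnegative with
    sum zero, so they are [degree k A] zeros. *)
Lemma neg_of_few_zeros v (A : {set 'I_n}) : in_ker (wreath_matrix R n k) v ->
  (entries_eq v 0 < degree k A)%N -> exists i, A \in wreath i /\ v i 0 < 0.
Proof.
move=> /in_kerP/(_ A) sum0 few.
have [/existsP[i /andP[]]|/existsPn no] :=
  boolP [exists i, (A \in wreath i) && (v i 0 < 0)]; first by exists i.
have v_ge0 i : A \in wreath i -> 0 <= v i 0.
  by move=> Ai; have := no i; rewrite Ai /= -leNgt.
have v0 := psumr_eq0P v_ge0 sum0.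
move: few; rewrite degree_index ltnNge; case/negP.
by apply/subset_leq_card/subsetP => i; rewrite !inE => /v0 ->.
Qed.

Lemma pos_of_neg v (A : {set 'I_n}) i : in_ker (wreath_matrix R n k) v ->
  A \in wreath i -> v i 0 < 0 -> exists j, A \in wreath j /\ 0 < v j 0.
Proof.
move=> /in_kerP/(_ A) sum0 Ai vi.
have [/existsP[j /andP[]]|/existsPn no] :=
  boolP [exists j, (A \in wreath j) && (0 < v j 0)]; first by exists j.
have v_le0 j : A \in wreath j -> 0 <= - v j 0.
  by move=> Aj; have := no j; rewrite Aj /= -leNgt oppr_ge0.
have sumN0 : \sum_(j | A \in wreath j) - v j 0 = 0.
  by rewrite sumrN sum0 oppr0.
have := psumr_eq0P v_le0 sumN0 Ai => /eqP.
by rewrite oppr_eq0 => /eqP vi0; rewrite vi0 ltxx in vi.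
Qed.

End Kernel.

(** * The equivalence *)

Section Equivalence.
Local Open Scope ring_scope.
Variables (R : realType) (n k m h g : nat).
Hypotheses (g_gt0 : (0 < g)%N) (h_gt0 : (0 < h)%N) (h_lt : (h < m.+3)%N).
Hypotheses (h_co : coprime m.+3 h) (nE : n = (m.+3 * g)%N) (kE : k = (h * g)%N).
Implicit Types v : 'cV[R]_#|wreaths n k|.
Local Notation M := (wreath_matrix R n k).

Let cardW F : F \in wreaths n k -> #|F| = m.+3.
Proof. exact: (card_wreath g_gt0 h_gt0 h_lt h_co nE kE). Qed.

Let subW F A : F \in wreaths n k -> A \in F -> A \in ksubsets n k.
Proof. exact: (wreath_sub g_gt0 h_gt0 h_lt h_co nE kE). Qed.

Let degree_gt0 (A : {set 'I_n}) : #|A| = k -> (0 < degree k A)%N.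
Proof. exact: (degree_gt0 g_gt0 h_gt0 h_lt h_co nE kE). Qed.

Let k_le_n : (k <= n)%N.
Proof. exact: (leq_k_n h_lt nE kE). Qed.

Lemma card_ksubsets : #|ksubsets n k| = 'C(n, k).
Proof. by rewrite card_draws card_ord. Qed.

(** As [n = m.+3 * g], the quotient is ['C(n, k) / m.+3], the number of wreaths
    in a decomposition. *)
Lemma ratio_eq (p : nat) :
  p%:R = (g * 'C(n, k))%:R / n%:R :> R <-> (p * m.+3 = 'C(n, k))%N.
Proof.
have n0 : (n%:R : R) != 0 by rewrite pnatr_eq0 nE muln_eq0 /= -lt0n.
split=> [/(canLR (mulfVK n0))|pC].
  move/eqP; rewrite -natrM eqr_nat nE mulnA mulnC eqn_pmul2l // => /eqP.
  by [].
apply: (canRL (mulfK n0)); rewrite -natrM; congr _%:R.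
by rewrite [X in (p * X)%N]nE mulnA pC mulnC.
Qed.

Lemma ratio_le (p : nat) :
  (p%:R <= (g * 'C(n, k))%:R / n%:R :> R) = (p * m.+3 <= 'C(n, k))%N.
Proof.
have n0 : (0 : R) < n%:R by rewrite ltr0n nE muln_gt0.
rewrite ler_pdivlMr // -natrM ler_nat [X in (p * X)%N]nE mulnA mulnC.
by rewrite leq_pmul2l.
Qed.

(** Sum the kernel equations over all sets: every wreath is counted [m.+3]
    times. *)
Lemma sum_ker v : in_ker M v -> \sum_i v i 0 = 0.
Proof.
move=> /in_kerP sum0.
have : \sum_A \sum_(j | A \in wreath j) v j 0 = 0 by apply: big1.
rewrite (exchange_big_dep predT) //=.
rewrite (eq_bigr (fun j => v j 0 *+ m.+3)) => [|j _]; last first.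
  by rewrite sumr_const cardW ?wreath_in.
by rewrite sumrMnl => /eqP; rewrite mulrn_eq0 => /eqP.
Qed.

Lemma decomposition_size (D : {set {set {set 'I_n}}}) :
  D \subset wreaths n k -> trivIset D -> cover D = ksubsets n k ->
  (#|D| * m.+3 = 'C(n, k))%N.
Proof.
move=> /subsetP DW tD cD.
rewrite -card_ksubsets -cD -(eqP tD) -sum_nat_const.
by apply: eq_bigr => F /DW/cardW.
Qed.

(** The wreaths with a positive entry cover the k-subsets, and their number
    leaves no room for an overlap. *)
Lemma decomposition_of_pos v : in_ker M v ->
  (entries_pos v)%:R <= (g * 'C(n, k))%:R / n%:R :> R ->
  (forall A : {set 'I_n}, A \in ksubsets n k ->
     exists i : 'I_#|wreaths n k|, A \in wreath i /\ v i 0 < 0) ->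
  wreath_decomposable n k.
Proof.
rewrite ratio_le => kerv few neg.
pose D := [set wreath i | i in [set i | 0 < v i 0]].
have cardD : #|D| = entries_pos v by rewrite card_imset //; apply: enum_val_inj.
have DW : D \subset wreaths n k.
  by apply/subsetP => _ /imsetP[i _ ->]; apply: wreath_in.
have covD : cover D = ksubsets n k.
  apply/setP => A; apply/bigcupP/idP => [[F /(subsetP DW)]|/neg[i [Ai vi]]].
    exact: subW.
  have [j [Aj vj]] := pos_of_neg kerv Ai vi.
  by exists (wreath j) => //; apply: imset_f; rewrite inE.
exists D; split=> //; have := leq_card_cover D; rewrite /leqif => -[_ <-].
have sizeD : (\sum_(F in D) #|F| = entries_pos v * m.+3)%N.
  by rewrite -cardD -sum_nat_const; apply: eq_bigr => F /(subsetP DW)/cardW.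
rewrite eqn_leq leq_card_cover sizeD covD card_ksubsets.
exact: few.
Qed.

(** Among the [d] wreaths containing a k-subset exactly one is in [D], so the
    values [d - 1] on [D] and [-1] elsewhere sum to zero there. *)
Lemma two_valued_of_decomposition : (1 < k)%N -> ((1 < g) || (h.+1 < m.+3))%N ->
  wreath_decomposable n k ->
  exists v, in_ker M v /\
    exists a b : R,
      [/\ a <> b, codom (fun i => v i 0) =i [:: a; b]
        & (entries_eq v a)%:R = (g * 'C(n, k))%:R / n%:R :> R].
Proof.
move=> k1 gh [D [DW tD cD]].
have /card_gt0P[A0 A0k] : (0 < #|ksubsets n k|)%N.
  by rewrite card_ksubsets bin_gt0.
pose d := degree k A0.
have dE (A : {set 'I_n}) : A \in ksubsets n k -> degree k A = d.
  move: A0k; rewrite !inE => /eqP A0k /eqP Ak; apply/eqP.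
  have C_gt0 : (0 < 'C(n, k))%N by rewrite bin_gt0.
  by rewrite -(eqn_pmul2l C_gt0) /d !(degree_count g_gt0 h_gt0 h_lt h_co nE kE).
have d_gt0 : (0 < d)%N by apply: degree_gt0; move: A0k; rewrite inE => /eqP.
have same F F' (A : {set 'I_n}) :
    F \in D -> F' \in D -> A \in F -> A \in F' -> F = F'.
  move=> FD F'D AF AF'.
  by rewrite -(def_pblock tD FD AF) (def_pblock tD F'D AF').
have index F : F \in wreaths n k -> exists i : 'I_#|wreaths n k|, wreath i = F.
  by move=> FW; exists (enum_rank_in FW F); rewrite /wreath enum_rankK_in.
pose v : 'cV[R]_#|wreaths n k| :=
  \col_i (if wreath i \in D then d%:R - 1 else - 1).
have [iD iDP] : exists i : 'I_#|wreaths n k|, wreath i \in D.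
  move: A0k; rewrite -cD => /bigcupP[F FD _].
  by have [i iF] := index _ (subsetP DW _ FD); exists i; rewrite iF.
have [iN iNP] : exists i : 'I_#|wreaths n k|, wreath i \notin D.
  have [F [F' [FW F'W nFF' [A /setIP[AF AF']]]]] :=
    wreaths_overlap g_gt0 h_gt0 h_lt h_co nE kE k1 gh.
  have [[i iF] [j jF']] := (index _ FW, index _ F'W).
  have [FD|FD] := boolP (F \in D); last by exists i; rewrite iF.
  exists j; rewrite jF'; apply: contra nFF' => F'D.
  by apply/eqP; apply: same AF AF'.
exists v; split.
  apply/in_kerP => A; have [Ak|Ak] := boolP (A \in ksubsets n k); last first.
    by apply: big1 => j Aj; case/negP: Ak; apply: subW (wreath_in j) Aj.
  move: (Ak); rewrite -cD => /bigcupP[F FD AF].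
  have [i iF] := index _ (subsetP DW _ FD).
  rewrite (eq_bigr (fun j => (if j == i then d%:R else 0) - 1)); last first.
    move=> j Aj; rewrite mxE; case: eqP => [->|ji]; first by rewrite iF FD.
    case: ifP => jD; last by rewrite add0r.
    case: ji; apply: enum_val_inj.
    by rewrite -!/(wreath _) iF (same _ _ _ jD FD Aj).
  rewrite big_split /= -big_mkcondr /= (big_pred1 i) => [|j]; last first.
    by rewrite /= andbC; case: eqP => // ->; rewrite iF AF.
  rewrite sumr_const -(dE A Ak) degree_index cardsE mulNrn.
  exact: subrr.
have d1 : d%:R - 1 <> -1 :> R.
  by move/eqP; rewrite -subr_eq0 opprK subrK pnatr_eq0; lia.
exists (d%:R - 1), (-1); split=> //.
  move=> x; apply/codomP/idP => [[i ->]|].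
    by rewrite mxE !inE; case: ifP; rewrite eqxx ?orbT.
  rewrite !inE => /orP[] /eqP ->; first by exists iD; rewrite mxE iDP.
  by exists iN; rewrite mxE (negPf iNP).
apply/ratio_eq; rewrite -(decomposition_size DW tD cD); congr (_ * _)%N.
rewrite /entries_eq -(card_imset _ (@enum_val_inj _ (mem (wreaths n k)))).
congr #|pred_of_set _|; apply/setP => F; apply/imsetP/idP => [[i]|FD].
  rewrite inE mxE -/(wreath i) => iv ->; move: iv; case: ifP => // _.
  by rewrite eq_sym => /eqP.
have [i iF] := index _ (subsetP DW _ FD).
by exists i; rewrite // inE mxE iF FD eqxx.
Qed.

(** Both values are attained and the total is zero, so they have opposite
    signs; the vector or its opposite is positive exactly where [v] is [a]. *)
Lemma signed_of_two_valued v (a b : R) :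
  in_ker M v -> a <> b -> codom (fun i => v i 0) =i [:: a; b] ->
  (entries_eq v a)%:R = (g * 'C(n, k))%:R / n%:R :> R ->
  exists w : 'cV[R]_#|wreaths n k|,
    [/\ in_ker M w, (entries_pos w * m.+3 = 'C(n, k))%N & entries_eq w 0 = 0%N].
Proof.
move=> kerv /eqP ab vab /ratio_eq va.
have v_or i : (v i 0 == a) || (v i 0 == b).
  by have := codom_f (fun i => v i 0) i; rewrite vab !inE.
have attained x : x \in [:: a; b] -> (0 < entries_eq v x)%N.
  by rewrite -vab => /codomP[i xi]; apply/card_gt0P; exists i; rewrite inE xi.
have p_gt0 := attained a (mem_head _ _).
have q_gt0 : (0 < entries_eq v b)%N by apply: attained; rewrite !inE eqxx orbT.
have balance : a *+ entries_eq v a + b *+ entries_eq v b = 0.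
  rewrite -(sum_ker kerv) (bigID (fun i => v i 0 == a)) /=.
  rewrite /entries_eq -!sumr_const; congr (_ + _).
    by apply: eq_big => i; rewrite inE // => /eqP.
  apply: eq_big => i; rewrite inE; last by move=> /eqP.
  have := v_or i; case: (eqVneq (v i 0) a) => [->|_] /=; last by [].
  by rewrite (negPf ab).
have zeros (w : 'cV[R]_#|wreaths n k|) :
    (forall i, w i 0 != 0) -> entries_eq w 0 = 0%N.
  move=> w0; apply/eqP; rewrite cards_eq0 -subset0; apply/subsetP => i.
  by rewrite inE (negPf (w0 i)).
have posE (w : 'cV[R]_#|wreaths n k|) :
    (forall i, (0 < w i 0) = (v i 0 == a)) -> entries_pos w = entries_eq v a.
  by move=> wE; apply: eq_card => i; rewrite !inE wE.
have [a0|a0|a0] := ltgtP a 0.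
- have b0 : 0 < b.
    rewrite -(pmulrn_lgt0 _ q_gt0) -(ltrD2l (a *+ entries_eq v a)).
    rewrite balance addr0.
    by rewrite pmulrn_llt0.
  exists (- v); split; first exact: in_kerN.
    rewrite posE // => i; rewrite mxE oppr_gt0.
    case/orP: (v_or i) => /eqP ->; first by rewrite ?eqxx ?a0.
    by rewrite eq_sym (negPf ab) ltNge ltW.
  apply: zeros => i; rewrite mxE oppr_eq0.
  by case/orP: (v_or i) => /eqP ->; rewrite ?(lt_eqF a0) ?(gt_eqF b0).
- have b0 : b < 0.
    rewrite -(pmulrn_llt0 _ q_gt0) -(ltrD2l (a *+ entries_eq v a)).
    rewrite balance addr0.
    by rewrite pmulrn_lgt0.
  exists v; split=> //.
    rewrite posE // => i.
    case/orP: (v_or i) => /eqP ->; first by rewrite ?eqxx ?a0.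
    by rewrite eq_sym (negPf ab) ltNge ltW.
  apply: zeros => i.
  by case/orP: (v_or i) => /eqP ->; rewrite ?(lt_eqF b0) ?(gt_eqF a0).
move: balance; rewrite a0 mul0rn add0r => /eqP; rewrite mulrn_eq0.
by rewrite (gtn_eqF q_gt0) /= => /eqP b0; rewrite a0 b0 eqxx in ab.
Qed.

End Equivalence.

Local Open Scope ring_scope.

Theorem proposition1p4 (R : realType) (n k : nat)
    (k_gt0 : (0 < k)%N) (k_le_n : (k <= n)%N)
    (* In these cases the distinct wreaths are pairwise disjoint, M is an
       invertible scalar matrix, and the equivalence fails. *)
    (k_neq1 : k <> 1%N) (k_neq_n1 : k <> n.-1) (k_neq_n : k <> n)
    (n_neq_2k : n <> (2 * k)%N) :
  let g := gcdn n k in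
  let M := wreath_matrix R n k in
  [<->
   (* (a) *)
   wreath_decomposable n k;
   (* (b) *)
   exists v, in_ker M v /\
     exists a b : R,
       [/\ a <> b,
           codom (fun i => v i 0) =i [:: a; b]
         & (entries_eq v a)%:R = (g * 'C(n, k))%:R / n%:R :> R];
   (* (c) *)
   (~~ (k %| n)%N ->
     exists v,
       [/\ in_ker M v,
           (entries_pos v)%:R <= (g * 'C(n, k))%:R / n%:R :> R
         & (entries_eq v 0)%:R
             < ((n - k)`! * k`!)%:R / (2 * g`! ^ (n %/ g))%:R :> R])
   /\
   ((k %| n)%N ->
     exists v,
       [/\ in_ker M v,
           (entries_pos v <= 'C(n.-1, k.-1))%N
         & (entries_eq v 0)%:R
             < (n * (n - k)`!)%:R
               / (k * k`! ^ (n %/ k).-1 * (n %/ k)`!)%:R :> R]);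
   (* (d) *)
   exists v,
     [/\ in_ker M v,
         (entries_pos v)%:R <= (g * 'C(n, k))%:R / n%:R :> R
       & forall A : {set 'I_n}, A \in ksubsets n k ->
           exists i : 'I_#|wreaths n k|, A \in wreath i /\ v i 0 < 0]].
Proof.
move=> g M.
have n_gt0 : (0 < n)%N by lia.
have g_gt0 : (0 < g)%N by rewrite gcdn_gt0 k_gt0 orbT.
have [h kE] : exists h, k = (h * g)%N.
  by exists (k %/ g)%N; rewrite divnK // dvdn_gcdr.
have [m0 nE0] : exists m0, n = (m0 * g)%N.
  by exists (n %/ g)%N; rewrite divnK // dvdn_gcdl.
have h_gt0 : (0 < h)%N by nia.
have h_lt0 : (h < m0)%N by nia.
have [m mE] : exists m, m0 = m.+3.
  exists (m0 - 3)%N; have : (h = 1 \/ 1 < h)%N by lia.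
  by case=> hh; nia.
rewrite mE in h_lt0 nE0.
have h_co : coprime m.+3 h.
  apply/eqP; apply/eqP; rewrite -(eqn_pmul2r g_gt0) muln_gcdl mul1n.
  by rewrite -nE0 -kE.
have n_div_g : (n %/ g = m.+3)%N by rewrite nE0 mulnK.
have k_dvd : (k %| n)%N = (h == 1%N).
  apply/idP/eqP => [|h1]; last by rewrite kE nE0 h1 mul1n dvdn_mull.
  rewrite kE nE0 dvdn_pmul2r // => h_dvd.
  by move: h_co; rewrite /coprime gcdnC; move/gcdn_idPl: h_dvd => -> /eqP.
have k1 : (1 < k)%N by lia.
have gh : ((1 < g) || (h.+1 < m.+3))%N.
  by apply/orP; nia.
have a_to_b := @two_valued_of_decomposition R n k m h g
  g_gt0 h_gt0 h_lt0 h_co nE0 kE k1 gh.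
have signed v a b := @signed_of_two_valued R n k m h g
  g_gt0 h_gt0 h_lt0 h_co nE0 kE v a b.
have le_ratio := @ratio_le R n k m g g_gt0 nE0.
have d_of_few v : in_ker M v -> (entries_pos v * m.+3 <= 'C(n, k))%N ->
    (forall A : {set 'I_n}, #|A| = k -> entries_eq v 0 < degree k A)%N ->
    exists v : 'cV[R]_#|wreaths n k|,
     [/\ in_ker M v,
         (entries_pos v)%:R <= (g * 'C(n, k))%:R / n%:R :> R
       & forall A : {set 'I_n}, A \in ksubsets n k ->
           exists i : 'I_#|wreaths n k|, A \in wreath i /\ v i 0 < 0].
  move=> kerv pos few; exists v; split=> //; first by rewrite le_ratio.
  by move=> A; rewrite inE => /eqP Ak; apply: neg_of_few_zeros kerv (few A Ak).
tfae=> //.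
- case=> v [kerv [a [b [ab vab va]]]].
  have [w [kerw posw zerow]] := signed v a b kerv ab vab va.
  split=> [_|kn]; exists w; split=> //; rewrite ?zerow.
  + by rewrite le_ratio posw.
  + by rewrite divr_gt0 // ltr0n ?muln_gt0 ?expn_gt0 ?fact_gt0.
  + move: kn; rewrite k_dvd => /eqP h1.
    rewrite -(leq_pmul2r (isT : 0 < m.+3)%N) posw.
    have := mul_bin_diag n k.-1; rewrite prednK //.
    by move: 'C(n, k) 'C(n.-1, k.-1) nE0 kE => x y; rewrite h1; nia.
  + rewrite divr_gt0 // ltr0n ?muln_gt0 ?expn_gt0 ?fact_gt0 ?n_gt0 //.
    by rewrite k_gt0.
- case=> c1 _.
  have [[h1 h2]|h_ext] :
      (1 < h /\ h.+1 < m.+3)%N \/ (h = 1 \/ h.+1 = m.+3)%N by lia.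
    have [|v [kerv pos few]] := c1; first by rewrite k_dvd; lia.
    apply: (d_of_few v kerv); first by rewrite -le_ratio.
    move=> A Ak; have := degree_ge g_gt0 h_gt0 h_lt0 h_co nE0 kE Ak h1 h2.
    have Y_gt0 : (0 < 2 * g`! ^ m.+3)%N by rewrite muln_gt0 expn_gt0 fact_gt0.
    move: few; rewrite n_div_g ltr_pdivlMr ?ltr0n // -natrM ltr_nat => few le.
    by rewrite -(ltn_pmul2r Y_gt0); apply: leq_trans few le.
  (* The zero bound of (c) says nothing here, but (a), hence (d), holds. *)
  have := decomposable_extreme g_gt0 h_gt0 h_lt0 h_co nE0 kE h_ext.
  move=> /a_to_b[v [kerv [a [b [ab vab va]]]]].
  have [w [kerw posw zerow]] := signed v a b kerv ab vab va.
  apply: (d_of_few w kerw); first by rewrite posw.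
  by move=> A Ak; rewrite zerow (degree_gt0 g_gt0 h_gt0 h_lt0 h_co nE0 kE Ak).
case=> v [kerv pos neg].
exact: (decomposition_of_pos g_gt0 h_gt0 h_lt0 h_co nE0 kE kerv pos neg).
Qed.
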